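(* Let $N\ge3$ and let $\Omega\subsetneq\mathbb{R}^N$ be a domain which supports the Hardy–Sobolev–Maz'ya inequality with constant $C_{HSM}>0$ and such that $\Delta d_\Omega\ge0$ in the sense of distributions in $\Omega$. Endow $\Omega$ with the (generally rough) metric $g=d_\Omega^{\frac{2}{N-2}}|dx|^2$. Then, for all $v\in C_0^\infty(\Omega)$, $$C_{HSM}^{1/2}\left(\int_\Omega|v|^{2^*}dV_g\right)^{\frac1{2^*}}\le\left(\int_\Omega|\nabla_gv|_g^2\,dV_g\right)^{\frac12},$$ where $2^*=\frac{2N}{N-2}$.
   Context: $d_\Omega(x)=\operatorname{dist}(x,\partial\Omega)$. $\Omega$ supports the Hardy–Sobolev–Maz'ya inequality if there is a constant $C_{HSM}>0$ such that for all $u\in C_0^\infty(\Omega)$ $$\int_\Omega|\nabla u|^2dx-\frac14\int_\Omega\frac{|u|^2}{d_\Omega^2}dx\ge C_{HSM}\left(\int_\Omega|u|^{\frac{2N}{N-2}}dx\right)^{\frac{N-2}{N}}.$$ $\Delta d_\Omega\ge0$ in the sense of distributions means $\int_\Omega d_\Omega\Delta\psi\,dx\ge0$ for all $0\le\psi\in C_0^\infty(\Omega)$. $|dx|^2$ is the Euclidean metric. With $A=d_\Omega^{1/(N-2)}$, so $g=A^2|dx|^2$, the Riemannian gradient, norm and volume are given by $\nabla_g v=A^{-2}\nabla v$, $|\nabla_gv|_g^2=A^{-2}|\nabla v|^2$, $dV_g=A^N\,dx$. *)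

(* Defs.v *)
From HB Require Import structures.
From mathcomp Require Import all_boot all_order all_algebra.
From mathcomp Require Import all_classical all_reals all_analysis
  measurable_realfun.

Set Implicit Arguments.
Unset Strict Implicit.
Unset Printing Implicit Defensive.

Import Order.TTheory GRing.Theory Num.Theory.
Import numFieldNormedType.Exports.

Local Open Scope classical_set_scope.
Local Open Scope ring_scope.

Section borel_rV.
Context (R : realType).
Local Notation T := (measurableTypeR R).

Definition borel_rV n := g_sigma_algebraType (@open 'rV[R]_n).

Lemma open_measurable_rV n (U : set 'rV[R]_n) :
  open U -> measurable (U : set (borel_rV n)).
Proof. by move=> oU; exact: sub_sigma_algebra. Qed.

Lemma continuous_measurable_fun_rV n (f : 'rV[R]_n -> R) :
  continuous f -> measurable_fun [set: borel_rV n] (f : borel_rV n -> T).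
Proof.
move=> cf; apply: (measurability _ (RGenOInfty.measurableE R)).
move=> _ [_ [a ->] <-]; rewrite setTI.
apply: open_measurable_rV; apply: open_comp; last exact: interval_open.
by move=> x _; exact: cf.
Qed.

Lemma measurable_fun_rVP d (S : measurableType d) n (f : S -> 'rV[R]_n) :
  (forall i, measurable_fun [set: S] (fun s => f s 0 i : T)) ->
  measurable_fun [set: S] (f : S -> borel_rV n).
Proof.
move=> mf; apply: measurability => // _ [U oU <-].
rewrite setTI.
pose box (q : {ffun 'I_n -> rat * rat}) : set 'rV[R]_n :=
  [set v | forall i, ratr (q i).1 < v 0 i < ratr (q i).2].
have -> : f @^-1` U =
    \bigcup_q (if `[<box q `<=` U>] then f @^-1` box q else set0).
  apply/seteqP; split=> [s Us|s [q _]]; last first.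
    by case: ifPn => // /asboolP qU; exact: qU.
  have /nbhs_ballP[e /= e0 eU] := open_nbhs_nbhs (conj oU Us).
  have Q (i : 'I_n) : {p : rat * rat | [/\ f s 0 i - e < ratr p.1,
      ratr p.1 < f s 0 i, f s 0 i < ratr p.2 & ratr p.2 < f s 0 i + e]}.
    have /rat_in_itvoo/cid[p1 /itvP p1E] : f s 0 i - e < f s 0 i.
      by rewrite ltrBlDr ltrDl.
    have /rat_in_itvoo/cid[p2 /itvP p2E] : f s 0 i < f s 0 i + e.
      by rewrite ltrDl.
    by exists (p1, p2); rewrite !p1E !p2E.
  exists [ffun i => sval (Q i)] => //.
  rewrite ifT; last first.
    apply/asboolP => v /= vq; apply: eU; split=> // i j; rewrite ord1.
    have := vq j; rewrite ffunE; case: (Q j) => p /= [a b c d'] /andP[vl vr].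
    rewrite /ball/= ltr_distlC; apply/andP; split.
      exact: lt_trans a vl.
    exact: lt_trans vr d'.
  by move=> i; rewrite ffunE; case: (Q i) => p [/= _ -> -> _].
apply: countable_bigcupT_measurable; first exact: countableP.
move=> q; case: ifPn => // _.
have -> : f @^-1` box q = \bigcap_(i in [set: 'I_n])
    ((fun s => f s 0 i : T) @^-1` `]ratr (q i).1, ratr (q i).2[%classic).
  apply/seteqP; split=> s /= qs i; first by move=> _; rewrite /= in_itv/=.
  by have := qs i Logic.I; rewrite /= in_itv.
apply: fin_bigcap_measurable => // i _.
by rewrite -[X in measurable X]setTI; apply: mf => //; exact: measurable_itv.
Qed.

End borel_rV.

Section lebesgue_rV.
Context (R : realType).
Local Notation T := (measurableTypeR R).
Local Notation V := (borel_rV R).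

Definition cons_rV n (p : T * V n) : V n.+1 :=
  row_mx (p.1%:M : 'rV_1) (p.2 : 'rV_n).

Definition uncons_rV n (v : V n.+1) : T * V n :=
  ((v : 'rV_n.+1) 0 0, rsubmx (v : 'rV_(1 + n))).

Lemma measurable_cons_rV n : measurable_fun [set: T * V n] (@cons_rV n).
Proof.
apply: measurable_fun_rVP => i.
case: (split_ordP (i : 'I_(1 + n))) => j ->.
  rewrite (_ : (fun _ => _) = fst); first exact: measurable_fst.
  by apply/funext => p; rewrite [LHS]row_mxEl mxE ord1.
rewrite (_ : (fun _ => _) = (fun v : V n => (v : 'rV_n) 0 j) \o snd).
  apply: measurableT_comp; last exact: measurable_snd.
  by apply: continuous_measurable_fun_rV; exact: coord_continuous.
by apply/funext => p; rewrite [LHS]row_mxEr.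
Qed.

Lemma measurable_uncons_rV n : measurable_fun [set: V n.+1] (@uncons_rV n).
Proof.
apply/measurable_fun_pairP; split.
  by apply: continuous_measurable_fun_rV; exact: coord_continuous.
apply: measurable_fun_rVP => i /=.
under eq_fun do rewrite mxE.
by apply: continuous_measurable_fun_rV; exact: coord_continuous.
Qed.

Lemma cons_rVK n : cancel (@cons_rV n) (@uncons_rV n).
Proof.
move=> [x v]; congr pair; last by rewrite row_mxKr.
transitivity ((cons_rV (x, v) : 'rV_(1 + n)) 0 (lshift n 0)).
  by congr (cons_rV _ _ _); exact/val_inj.
by rewrite [LHS]row_mxEl mxE.
Qed.

Definition lebesgue_rVS n (m : {sigma_finite_measure set (V n) -> \bar R}) :
  set (V n.+1) -> \bar R := pushforward (@lebesgue_measure R \x m)%E (@cons_rV n).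

HB.instance Definition _ n (m : {sigma_finite_measure set (V n) -> \bar R}) :=
  Measure.copy (lebesgue_rVS m)
    (measure_function_pushforward__canonical__measure_function_Measure
      (@lebesgue_measure R \x m)%E (@measurable_cons_rV n)).

Lemma sigma_finite_lebesgue_rVS n
    (m : {sigma_finite_measure set (V n) -> \bar R}) :
  sigma_finite [set: V n.+1] (lebesgue_rVS m).
Proof.
have /sigma_finiteP[F [FT ndF Foo]] := sigma_finiteT (@lebesgue_measure R).
have /sigma_finiteP[G [GT ndG Goo]] := sigma_finiteT m.
exists (fun k => @uncons_rV n @^-1` (F k `*` G k)).
  rewrite -preimage_bigcup -(preimage_setT (@uncons_rV n)); congr (_ @^-1` _).
  rewrite -setXTT FT GT predeqE => -[x y]; split.
    move=> [/= [i _ Fx] [j _ Gy]]; exists (maxn i j) => //; split.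
    - by move: x Fx; exact/subsetPset/ndF/leq_maxl.
    - by move: y Gy; exact/subsetPset/ndG/leq_maxr.
  by move=> [i _ []/= ? ?]; split; exists i.
move=> k; have [? ?] := Foo k; have [? ?] := Goo k; split.
  rewrite -[X in measurable X]setTI; apply: measurable_uncons_rV => //.
  exact: measurableX.
rewrite /lebesgue_rVS /pushforward -comp_preimage.
rewrite (_ : _ \o _ = id); last by apply/funext => p /=; rewrite cons_rVK.
by rewrite preimage_id product_measure1E// lte_mul_pinfty// ge0_fin_numE.
Qed.

HB.instance Definition _ n (m : {sigma_finite_measure set (V n) -> \bar R}) :=
  Measure_isSigmaFinite.Build _ _ _ (lebesgue_rVS m)
    (sigma_finite_lebesgue_rVS m).

Fixpoint lebesgue_rV n : {sigma_finite_measure set (V n) -> \bar R} :=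
  match n with
  | 0 => \d_((0 : 'rV[R]_0) : V 0)
  | n'.+1 => lebesgue_rVS (lebesgue_rV n')
  end.

Lemma lebesgue_rV_box n (a b : 'rV[R]_n) : (forall i, a 0 i <= b 0 i) ->
  lebesgue_rV n [set v : V n | forall i, a 0 i <= (v : 'rV_n) 0 i <= b 0 i] =
  (\prod_(i < n) (b 0 i - a 0 i))%:E.
Proof.
elim: n a b => [a b _|n IH a b ab].
  by rewrite /= big_ord0 diracE mem_set// => -[].
set B := [set v | _].
pose a' : 'rV[R]_n := \row_i a 0 (lift ord0 i).
pose b' : 'rV[R]_n := \row_i b 0 (lift ord0 i).
pose B' := [set v : V n | forall i, a' 0 i <= (v : 'rV_n) 0 i <= b' 0 i].
have BE : @cons_rV n @^-1` B = `[a 0 0, b 0 0]%classic `*` B'.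
  have c0 p : (cons_rV p : 'rV_n.+1) 0 0 = p.1.
    by have /(congr1 fst) := cons_rVK p.
  have cS p i : (cons_rV p : 'rV_n.+1) 0 (lift ord0 i) = (p.2 : 'rV_n) 0 i.
    have /(congr1 snd) /= <- := cons_rVK p.
    rewrite [RHS]mxE; congr (fun_of_matrix (cons_rV p : 'rV_n.+1) _ _).
    exact/val_inj.
  apply/seteqP; split=> p /=.
    move=> Bp; split; first by rewrite in_itv/= -(c0 p); exact: Bp.
    by move=> i; rewrite !mxE -(cS p); exact: Bp.
  rewrite in_itv/= => -[p1 p2] i; case: (unliftP ord0 i) => [j ->|->].
    by rewrite cS; have := p2 j; rewrite !mxE.
  by rewrite c0.
have mB' : measurable B'.
  rewrite (_ : B' = \bigcap_(i in [set: 'I_n])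
    ((fun v : V n => (v : 'rV_n) 0 i : T) @^-1` `[a' 0 i, b' 0 i]%classic)).
    apply: fin_bigcap_measurable => // i _.
    rewrite -[X in measurable X]setTI.
    apply: continuous_measurable_fun_rV; first exact: coord_continuous.
      exact: measurableT.
    exact: measurable_itv.
  apply/seteqP; split=> v /= Hv i; first by move=> _; rewrite /= in_itv/=.
  by have := Hv i Logic.I; rewrite /= in_itv.
rewrite /= /lebesgue_rVS /pushforward BE product_measure1E//.
rewrite [X in (X * _)%E]lebesgue_measure_itv/= lte_fin IH; last by move=> i; rewrite !mxE.
rewrite big_ord_recl/= EFinM; congr (_ * _)%E.
  have := ab 0; rewrite le_eqVlt => /predU1P[->|->//].
  by rewrite ltxx subrr.
by congr EFin; apply: eq_bigr => i _; rewrite !mxE.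
Qed.

End lebesgue_rV.

Section euclidean_calculus.
Context (R : realType) (n : nat).
Implicit Types (Om : set 'rV[R]_n) (u : 'rV[R]_n -> R).

(* The library norm on row vectors is the sup norm; it induces the same
   topology and derivatives, but not the same distances. *)
Definition enorm (w : 'rV[R]_n) : R := Num.sqrt (\sum_i w 0 i ^+ 2).

Definition partial (i : 'I_n) u : 'rV[R]_n -> R :=
  fun x => 'D_(delta_mx 0 i) u x.

Definition gradient u (x : 'rV[R]_n) : 'rV[R]_n := \row_i partial i u x.

Definition laplacian u (x : 'rV[R]_n) : R := \sum_i partial i (partial i u) x.

Fixpoint Cn (k : nat) u : Prop :=
  continuous u /\
  if k is k'.+1 then
    forall i, (forall x, derivable u x (delta_mx 0 i)) /\ Cn k' (partial i u)
  else True.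

Definition smooth u := forall k, Cn k u.

Definition support_closure u := closure [set x | u x != 0].

(* Elements of C_0^oo(Om) are identified with their extensions by zero. *)
Definition test_function Om u :=
  [/\ smooth u, compact (support_closure u) & support_closure u `<=` Om].

Definition is_domain Om := [/\ open Om, connected Om & Om !=set0].

Definition boundary Om := closure Om `\` Om°.

Definition boundary_dist Om (x : 'rV[R]_n) : R :=
  inf [set enorm (x - y) | y in boundary Om].

Definition dist_subharmonic Om := forall psi, test_function Om psi ->
  (forall x, 0 <= psi x) ->
  (0 <= \int[lebesgue_rV R n]_(x in Om)
          (boundary_dist Om x * laplacian psi x)%:E)%E.

Definition sobolev_exponent : R := 2 * n%:R / (n%:R - 2).

Definition hardy_sobolev_mazya Om (C : R) := forall u, test_function Om u ->
  (\int[lebesgue_rV R n]_(x in Om) (enorm (gradient u x) ^+ 2)%:E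
   - (4^-1)%R%:E * \int[lebesgue_rV R n]_(x in Om)
                   (`|u x| ^+ 2 / boundary_dist Om x ^+ 2)%R%:E
   >= C%:E * (\int[lebesgue_rV R n]_(x in Om) (`|u x| `^ sobolev_exponent)%R%:E)
               `^ ((n%:R - 2) / n%:R)%R)%E.

End euclidean_calculus.

Section conformal_metric.
Context (R : realType) (n : nat).
(* g = A ^ 2 |dx| ^ 2 *)
Context (A : 'rV[R]_n -> R).

Definition conformal_gradient (v : 'rV[R]_n -> R) (x : 'rV[R]_n) : 'rV[R]_n :=
  A x ^- 2 *: gradient v x.

Definition conformal_norm (x w : 'rV[R]_n) : R := A x * enorm w.

(* \int_D f dV_g with dV_g = A ^ n dx *)
Definition conformal_integral (D : set 'rV[R]_n) (f : 'rV[R]_n -> R) : \bar R :=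
  (\int[lebesgue_rV R n]_(x in D) (f x * A x ^+ n)%:E)%E.

End conformal_metric.

Definition dist_factor (R : realType) n (Om : set 'rV[R]_n) (x : 'rV[R]_n) : R :=
  boundary_dist Om x `^ (n%:R - 2)^-1.

(* Main.v *)
Require Import Defs.
From mathcomp Require Import all_boot all_order all_algebra.
From mathcomp Require Import all_classical all_reals all_analysis.
From mathcomp Require Import measurable_realfun ring lra.

Set Implicit Arguments.
Unset Strict Implicit.
Unset Printing Implicit Defensive.

Import Order.TTheory GRing.Theory Num.Theory.
Import numFieldNormedType.Exports.

Local Open Scope classical_set_scope.
Local Open Scope ring_scope.

(** Write [d] for the distance to the boundary. The inequality comes from
    substituting [u = d^(1/2) v] in the Hardy-Sobolev-Maz'ya inequality. One has
    [|grad u|^2 = d |grad v|^2 + 1/2 grad(v^2).grad d + 1/4 v^2 |grad d|^2 / d],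
    and [|grad d| = 1] almost everywhere, so that the Hardy term
    [1/4 u^2 / d^2 = 1/4 v^2 / d] cancels the last summand. Integrating the
    middle summand by parts gives [- 1/2 int d Lap(v^2)], which is nonpositive
    because [d] is subharmonic. What is left is
    [C (int d^(N/(N-2)) |v|^p)^((N-2)/N) <= int d |grad v|^2], with [p] the
    Sobolev exponent; this is the square of the claim, since the conformal
    factor [A = d^(1/(N-2))] satisfies [A^N = d^(N/(N-2))] and
    [A^(N-2) = d] ([dist_factor_volume], [conformal_energy_density]).

    As [d] is merely Lipschitz, [u] is not a test function. The substitution is
    therefore carried out with a smooth function [h] in place of [d]
    ([ground_state_identity]). Two properties of [h] suffice: it is within a
    factor [1 +- e] of [d] on the support of [v], and [|grad h| <= 1]. They
    leave an error of size [O(e)] in the integrated inequality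
    ([pointwise_bound], [perturbed_hsm]), and [e] tends to [0]
    ([lee_vanishing_error]). In particular the integral of [h Lap(v^2)] differs by
    [O(e)] from that of [d Lap(v^2)], whose sign is known.

    Such an [h] can be written down without mollification
    ([smooth_boundary_dist]): it is the power mean
    [(sum_y (del + |x - y|^2)^(-k/2))^(-1/k)], with [del] small and [k] large,
    where [y] ranges over a finite set of boundary points that contains, for
    every point [x] of the support of [v], one at distance nearly [d x] from
    [x]. It is smooth on the whole space because [del > 0].

    The integration by parts reduces to the vanishing of the integral of a
    partial derivative of a compactly supported function
    ([integral_partial_eq0]), which follows from Fubini's theorem and the
    fundamental theorem of calculus in one coordinate. *)

(** * Calculus of smooth functions *)

Section smooth_functions.
Context (R : realType) (n : nat).
Local Notation E := 'rV[R]_n.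
Implicit Types (u f g : E -> R) (x : E).

(** A directional derivative is a derivative in one variable, which makes
    the one-variable chain rule available. *)
Lemma derive_line f x (v : E) : 'D_v f x = 'D_1 (fun t : R => f (t *: v + x)) 0.
Proof.
rewrite /derive; set g1 := fun h => h^-1 *: _; set g2 := fun h => h^-1 *: _.
suff -> : g1 = g2 by [].
apply/funext => h; rewrite /g1 /g2 /=.
by rewrite addr0 scale0r add0r [h%:A]mulr1.
Qed.

Lemma is_derive_powR f x (v : E) (a : R) : 0 < f x -> derivable f x v ->
  is_derive x v (fun y => f y `^ a) (a * f x `^ (a - 1) * 'D_v f x).
Proof.
move=> fx /[dup] dfx /derivable1P/derivableP; rewrite -derive_line => df1.
have f0 : 0 < f (0 *: v + x) by rewrite scale0r add0r.
have := is_derive1_comp (is_derive1_powR a f0) df1.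
rewrite scale0r add0r => -[d1 d2]; split; first exact/derivable1P.
by rewrite derive_line.
Qed.

Section partial_rules.
Variable i : 'I_n.
Local Notation e := (delta_mx 0 i : E).

Lemma partial_cst (c : R) x :
  derivable (fun=> c) x e /\ partial i (fun=> c) x = 0.
Proof. by split; [exact: derivable_cst | exact: derive_cst]. Qed.

Lemma partialD f g x : derivable f x e -> derivable g x e ->
  derivable (fun y => f y + g y) x e /\
  partial i (fun y => f y + g y) x = partial i f x + partial i g x.
Proof. by move=> df dg; split; [exact: (derivableD df dg) | exact: (deriveD df dg)]. Qed.

Lemma partialM f g x : derivable f x e -> derivable g x e ->
  derivable (fun y => f y * g y) x e /\
  partial i (fun y => f y * g y) x = f x * partial i g x + g x * partial i f x.
Proof. by move=> df dg; split; [exact: (derivableM df dg) | exact: (deriveM df dg)]. Qed.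

Lemma partial_powR f x (a : R) : 0 < f x -> derivable f x e ->
  derivable (fun y => f y `^ a) x e /\
  partial i (fun y => f y `^ a) x = a * f x `^ (a - 1) * partial i f x.
Proof. by move=> fx /(is_derive_powR a fx)[]. Qed.

Lemma partial_coord (j : 'I_n) x :
  derivable (fun y : E => y 0 j) x e /\
  partial i (fun y : E => y 0 j) x = (i == j)%:R.
Proof.
have q : (fun h : R => h^-1 *: (((fun y : E => y 0 j) \o shift x) (h *: e)
    - (fun y : E => y 0 j) x)) @ 0^' --> ((i == j)%:R : R).
  apply: cvg_near_cst; near=> h.
  have h0 : h != 0 by near: h; exact: nbhs_dnbhs_neq.
  rewrite /= !mxE eqxx /= addrK [j == i]eq_sym.
  by rewrite [LHS]mulrA mulVf// mul1r.
split; first by apply/cvg_ex; exists (i == j)%:R.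
exact/cvg_lim.
Unshelve. all: by end_near.
Qed.

End partial_rules.

Lemma CnW k u : Cn k.+1 u -> Cn k u.
Proof.
elim: k u => [|k IH] u [cu du]; split=> // i.
by have [? ?] := du i; split=> //; exact: IH.
Qed.

Lemma Cn_cst k (c : R) : Cn k (fun _ : E => c).
Proof.
elim: k c => [|k IH] c; split=> //; do ?exact: cst_continuous.
move=> i; split=> [x|]; first exact: derivable_cst.
rewrite (_ : partial i _ = fun=> 0) //.
by apply/funext => x; exact: (partial_cst i c x).2.
Qed.

Lemma CnD k f g : Cn k f -> Cn k g -> Cn k (fun x => f x + g x).
Proof.
elim: k f g => [|k IH] f g [cf df] [cg dg].
  by split=> // x; apply: continuousD; [exact: cf|exact: cg].
split; first by move=> x; apply: continuousD; [exact: cf|exact: cg].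
move=> i; have [df1 df2] := df i; have [dg1 dg2] := dg i.
split=> [x|]; first exact: (partialD (df1 x) (dg1 x)).1.
rewrite (_ : partial i _ = fun x => partial i f x + partial i g x).
  exact: IH.
by apply/funext => x; exact: (partialD (df1 x) (dg1 x)).2.
Qed.

Lemma CnM k f g : Cn k f -> Cn k g -> Cn k (fun x => f x * g x).
Proof.
elim: k f g => [|k IH] f g cnf cng.
  by split=> // x; apply: continuousM; [exact: cnf.1|exact: cng.1].
have [[cf df] [cg dg]] := (cnf, cng).
split; first by move=> x; apply: continuousM; [exact: cf|exact: cg].
move=> i; have [df1 df2] := df i; have [dg1 dg2] := dg i.
split=> [x|]; first exact: (partialM (df1 x) (dg1 x)).1.
rewrite (_ : partial i _ = fun x => f x * partial i g x + g x * partial i f x).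
  by apply: CnD; apply: IH => //; exact: CnW.
by apply/funext => x; exact: (partialM (df1 x) (dg1 x)).2.
Qed.

(** The exponent is quantified inside the induction because the derivative
    of [f `^ a] involves [f `^ (a - 1)]. *)
Lemma Cn_powR k f (a : R) : (forall x, 0 < f x) -> Cn k f ->
  Cn k (fun x => f x `^ a).
Proof.
move=> f0.
have cpow b : continuous f -> continuous (fun x => f x `^ b).
  move=> cf x; apply: (@continuous_comp _ R R f (fun t : R => t `^ b)).
    exact: cf.
  apply/differentiable_continuous/derivable1_diffP.
  by apply: derivable_powR; rewrite in_itv/= f0.
elim: k f a f0 cpow => [|k IH] f a f0 cpow cnf; first by split=> //; exact/cpow/cnf.1.
have [cf df] := cnf.
split; first exact: cpow.
move=> i; have [df1 df2] := df i.
split=> [x|]; first exact: (partial_powR a (f0 x) (df1 x)).1.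
rewrite (_ : partial i _ = fun x => a * f x `^ (a - 1) * partial i f x).
  apply: (CnM _ df2); apply: (CnM (Cn_cst _ _)); apply: IH => //; exact: CnW.
by apply/funext => x; exact: (partial_powR a (f0 x) (df1 x)).2.
Qed.

Lemma Cn_coord k (j : 'I_n) : Cn k (fun x : E => x 0 j).
Proof.
case: k => [|k]; split=> //; do ?exact: coord_continuous.
move=> i; split=> [x|]; first exact: (partial_coord i j x).1.
rewrite (_ : partial i _ = fun=> (i == j)%:R); first exact: Cn_cst.
by apply/funext => x; exact: (partial_coord i j x).2.
Qed.

Lemma smooth_cst (c : R) : smooth (fun _ : E => c).
Proof. by move=> k; exact: Cn_cst. Qed.

Lemma smoothD f g : smooth f -> smooth g -> smooth (fun x => f x + g x).
Proof. by move=> sf sg k; exact: CnD. Qed.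

Lemma smoothM f g : smooth f -> smooth g -> smooth (fun x => f x * g x).
Proof. by move=> sf sg k; exact: CnM. Qed.

Lemma smooth_powR f (a : R) : (forall x, 0 < f x) -> smooth f ->
  smooth (fun x => f x `^ a).
Proof. by move=> f0 sf k; exact: Cn_powR. Qed.

Lemma smooth_coord (j : 'I_n) : smooth (fun x : E => x 0 j).
Proof. by move=> k; exact: Cn_coord. Qed.

Lemma smooth_sum (I : Type) (s : seq I) (F : I -> E -> R) :
  (forall i, smooth (F i)) -> smooth (fun x => \sum_(i <- s) F i x).
Proof.
move=> sF; elim: s => [|i s IH].
  by under eq_fun do rewrite big_nil; exact: smooth_cst.
by under eq_fun do rewrite big_cons; exact: smoothD.
Qed.

Lemma smoothX2 f : smooth f -> smooth (fun x => f x ^+ 2).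
Proof. by move=> sf; under eq_fun do rewrite expr2; exact: smoothM. Qed.

Lemma smooth_continuous f : smooth f -> continuous f.
Proof. by move=> /(_ 0%N)[]. Qed.

Lemma smooth_derivable i f x : smooth f -> derivable f x (delta_mx 0 i).
Proof. by move=> /(_ 1%N)[_ /(_ i)[]]. Qed.

Lemma smooth_partial i f : smooth f -> smooth (partial i f).
Proof. by move=> sf k; have [_ /(_ i)[]] := sf k.+1. Qed.

Lemma partialX2 i f x : derivable f x (delta_mx 0 i) ->
  partial i (fun y => f y ^+ 2) x = 2 * f x * partial i f x.
Proof.
move=> df; under eq_fun do rewrite expr2.
by rewrite (partialM df df).2; ring.
Qed.

(** The complement of [K] is open, so [f] is locally constant there. *)
Lemma partial_vanish i (K : set E) f : closed K ->
  (forall x, ~ K x -> f x = 0) -> forall x, ~ K x -> partial i f x = 0.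
Proof.
move=> cK fK x Kx.
rewrite /partial -(derive_cst (0 : R) x (delta_mx 0 i)); apply: near_eq_derive.
have := open_nbhs_nbhs (conj (closed_openC cK) Kx).
by apply: filterS => y /fK.
Qed.

Lemma partial_sum i (I : Type) (s : seq I) (F : I -> E -> R) x :
  (forall j, smooth (F j)) ->
  partial i (fun y => \sum_(j <- s) F j y) x = \sum_(j <- s) partial i (F j) x.
Proof.
move=> sF; elim: s => [|j s IH].
  by under eq_fun do rewrite big_nil; rewrite big_nil (partial_cst i 0 x).2.
under eq_fun do rewrite big_cons.
rewrite big_cons -IH (partialD _ _).2//; apply: smooth_derivable => //.
exact: smooth_sum.
Qed.

End smooth_functions.

(** * The Euclidean norm and the distance to the boundary *)

Lemma continuous_sum (R : realType) (T : topologicalType) (I : Type) (s : seq I)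
    (F : I -> T -> R) :
  (forall i, continuous (F i)) -> continuous (fun x => \sum_(i <- s) F i x).
Proof.
move=> cF; apply: continuous_big => [|i _]; last exact: cF.
exact: add_continuous.
Qed.

Section euclidean_norm.
Context (R : realType) (n : nat).
Local Notation E := 'rV[R]_n.
Implicit Types (a b w x y : E).

Lemma enorm_ge0 w : 0 <= enorm w.
Proof. exact: sqrtr_ge0. Qed.

Lemma enorm_sqr w : enorm w ^+ 2 = \sum_i w 0 i ^+ 2.
Proof. by rewrite sqr_sqrtr// sumr_ge0// => i _; exact: sqr_ge0. Qed.

Lemma enorm0 : enorm (0 : E) = 0.
Proof.
by rewrite /enorm big1 ?sqrtr0// => i _; rewrite mxE expr0n.
Qed.

Lemma enormZ (c : R) w : enorm (c *: w) = `|c| * enorm w.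
Proof.
rewrite /enorm -sqrtr_sqr -sqrtrM ?sqr_ge0// mulr_sumr; congr Num.sqrt.
by apply: eq_bigr => i _; rewrite mxE exprMn.
Qed.

Lemma enormB x y : enorm (x - y) = enorm (y - x).
Proof. by rewrite -opprB -scaleN1r enormZ normrN1 mul1r. Qed.

Lemma coord_le_enorm w i : `|w 0 i| <= enorm w.
Proof.
rewrite -sqrtr_sqr ler_wsqrtr// (bigD1 i)//= lerDl sumr_ge0// => j _.
exact: sqr_ge0.
Qed.

(** Expand [0 <= sum_i (B a_i - A b_i)^2] with [A] and [B] the two norms. *)
Lemma cauchy_schwarz a b : \sum_i a 0 i * b 0 i <= enorm a * enorm b.
Proof.
set A := enorm a; set B := enorm b; set P := \sum_i _.
have [A0|A0] := eqVneq A 0.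
  rewrite /P big1 ?A0 ?mul0r// => i _; have := coord_le_enorm a i.
  by rewrite -/A A0 normr_le0 => /eqP ->; rewrite mul0r.
have [B0|B0] := eqVneq B 0.
  rewrite /P big1 ?B0 ?mulr0// => i _; have := coord_le_enorm b i.
  by rewrite -/B B0 normr_le0 => /eqP ->; rewrite mulr0.
have AB : 0 < 2 * A * B by rewrite !mulr_gt0// lt0r ?A0 ?B0 enorm_ge0.
have : 0 <= \sum_i (B * a 0 i - A * b 0 i) ^+ 2.
  by apply: sumr_ge0 => i _; exact: sqr_ge0.
have -> : \sum_i (B * a 0 i - A * b 0 i) ^+ 2 =
    B ^+ 2 * \sum_i a 0 i ^+ 2 - (2 * A * B) * P + A ^+ 2 * \sum_i b 0 i ^+ 2.
  by rewrite /P !mulr_sumr -sumrB -big_split /=; apply: eq_bigr => i _; ring.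
rewrite -!enorm_sqr -/A -/B => H.
rewrite -subr_ge0 -(pmulr_rge0 _ AB).
by rewrite (_ : _ * (_ - _) = B ^+ 2 * A ^+ 2 - 2 * A * B * P + A ^+ 2 * B ^+ 2)//; ring.
Qed.

Lemma enormD a b : enorm (a + b) <= enorm a + enorm b.
Proof.
rewrite -(@ler_pXn2r _ 2) ?nnegrE ?addr_ge0 ?enorm_ge0// enorm_sqr sqrrD.
have -> : \sum_i (a + b) 0 i ^+ 2 =
    enorm a ^+ 2 + (\sum_i a 0 i * b 0 i) *+ 2 + enorm b ^+ 2.
  rewrite !enorm_sqr -sumrMnl -!big_split/=.
  by apply: eq_bigr => i _; rewrite mxE sqrrD.
by rewrite lerD2r lerD2l lerMn2r/= cauchy_schwarz.
Qed.

Lemma enorm_sum (I : Type) (s : seq I) (F : I -> E) :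
  enorm (\sum_(j <- s) F j) <= \sum_(j <- s) enorm (F j).
Proof.
elim: s => [|j s IH]; first by rewrite !big_nil enorm0.
by rewrite !big_cons (le_trans (enormD _ _))// lerD2l.
Qed.

Lemma continuous_enormB y : continuous (fun x => enorm (x - y)).
Proof.
have cB i : continuous (fun x : E => (x - y) 0 i).
  move=> z; rewrite (_ : (fun x : E => _) = fun x : E => x 0 i - y 0 i).
    by apply: continuousB; [exact: coord_continuous | exact: cst_continuous].
  by apply/funext => x; rewrite !mxE.
move=> x; apply: (@continuous_comp _ R R (fun x => \sum_i (x - y) 0 i ^+ 2)).
  by apply: continuous_sum => i z; under eq_fun do rewrite expr2;
    exact: (continuousM (cB i z) (cB i z)).
exact: sqrt_continuous.
Qed.

End euclidean_norm.

Section boundary_distance.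
Context (R : realType) (n : nat) (Om : set 'rV[R]_n).
Local Notation E := 'rV[R]_n.
Local Notation d := (boundary_dist Om).
Hypothesis dOm : is_domain Om.
Hypothesis OmT : Om <> setT.

(** If the boundary were empty, [Om] would be open and closed; its preimage
    under the segment from a point inside to a point outside would then
    contradict the connectedness of [[0, 1]]. *)
Lemma boundary_nonempty : boundary Om !=set0.
Proof.
have [oOm _ [x Omx]] := dOm.
have [z Omz] : exists z, ~ Om z.
  apply: contra_notP OmT => /forallNP h; apply/seteqP; split=> // z _.
  exact: (contrapT (h z)).
apply/set0P/eqP => bd0; have cOm : closed Om.
  rewrite closure_id; apply/seteqP; split; first exact: subset_closure.
  move=> y cy; apply: contrapT => Omy.
  suff : boundary Om y by rewrite bd0.
  by split=> // /interior_subset.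
pose f (t : R) : E := x + t *: (z - x).
have cf : continuous f.
  by move=> t; apply: cvgD; [exact: cvg_cst | apply: cvgZr_tmp; exact: cvg_id].
have /(_ (`[0, 1]%classic `&` f @^-1` Om)) conn := @segment_connected R 0 1.
have : (`[0, 1]%classic `&` f @^-1` Om) 1.
  rewrite conn.
  - by rewrite /= in_itv/= ler01 lexx.
  - by exists 0; split; rewrite /= ?in_itv/= ?lexx ?ler01// /f scale0r addr0.
  - by exists (f @^-1` Om) => //; apply: open_comp => // t _; exact: cf.
  - by exists (f @^-1` Om) => //; apply: preimage_closed => // t _; exact: cf.
by move=> [_]; rewrite /preimage /f /= scale1r addrC subrK.
Qed.

Let has_inf_dist x : has_inf [set enorm (x - y) | y in boundary Om].
Proof.
split; last by exists 0 => _ [y _ <-]; exact: enorm_ge0.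
by have [y by_] := boundary_nonempty; exists (enorm (x - y)), y.
Qed.

Lemma boundary_dist_le x y : boundary Om y -> d x <= enorm (x - y).
Proof. by move=> by_; apply: ge_inf; [exact: (has_inf_dist x).2 | exists y]. Qed.

Lemma le_boundary_dist x (c : R) :
  (forall y, boundary Om y -> c <= enorm (x - y)) -> c <= d x.
Proof.
move=> h; apply: lb_le_inf; first exact: (has_inf_dist x).1.
by move=> _ [y by_ <-]; exact: h.
Qed.

Lemma boundary_dist_lt x (c : R) : d x < c ->
  exists2 y, boundary Om y & enorm (x - y) < c.
Proof.
rewrite -subr_gt0 => dc; have [_ [y by_ <-]] := inf_adherent dc (has_inf_dist x).
by rewrite [X in _ < X]addrC subrK; exists y.
Qed.

Lemma boundary_dist_ge0 x : 0 <= d x.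
Proof. by apply: le_boundary_dist => y _; exact: enorm_ge0. Qed.

Lemma boundary_dist_lipschitz x x' : d x <= enorm (x - x') + d x'.
Proof.
rewrite -lerBlDl; apply: le_boundary_dist => y by_; rewrite lerBlDl.
apply: le_trans (boundary_dist_le x by_) _.
by rewrite -(subrKA x'); exact: enormD.
Qed.

Lemma continuous_boundary_dist : continuous d.
Proof.
move=> x; have FF : Filter (nbhs x) by exact: nbhs_filter.
apply/(@cvgrPdist_lt _ _ _ (nbhs x)) => e e0.
have /(@cvgrPdist_lt _ _ _ (nbhs x))/(_ e e0) :
    enorm (x' - x) @[x' --> x] --> (0 : R).
  rewrite -(enorm0 R n) -[X in enorm X](subrr x).
  exact: continuous_enormB.
apply: filterS => x'; rewrite sub0r normrN ger0_norm ?enorm_ge0// => xx'.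
rewrite ltr_distl; apply/andP; split; last first.
  by have := boundary_dist_lipschitz x x'; rewrite enormB; lra.
by have := boundary_dist_lipschitz x' x; lra.
Qed.

(** A ball for the sup norm contains the Euclidean ball of the same radius. *)
Lemma boundary_dist_gt0 x : Om x -> 0 < d x.
Proof.
move=> Omx; have [oOm _ _] := dOm.
have /nbhs_ballP[e /= e0 eOm] := open_nbhs_nbhs (conj oOm Omx).
apply: (lt_le_trans e0); apply: le_boundary_dist => y [_].
have /interior_id -> := oOm.
apply: contra_notP => /negP; rewrite -ltNge => xy; apply: eOm.
split=> [|i j]; first exact: e0.
rewrite ord1 /ball /=.
by have := coord_le_enorm (x - y) j; rewrite !mxE => /le_lt_trans; exact.
Qed.

End boundary_distance.

(** * Integrals of partial derivatives *)

Section integration.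
Context (R : realType).
Local Notation mu := (@lebesgue_rV R).
Local Notation V := (borel_rV R).

Lemma coord_le_norm n (w : 'rV[R]_n) i : `|w 0 i| <= `|w|.
Proof. by rewrite [leRHS]/Num.norm /= mx_normrE; apply: (le_bigmax _ _ (0, i)). Qed.

(** The norm here is the sup norm; sections of such a function along a
    coordinate are again of this kind, with the same [M]. *)
Definition bounded_support n (f : 'rV[R]_n -> R) :=
  exists M : R, forall x : 'rV[R]_n, M < `|x| -> f x = 0.

Lemma compact_bounded_support n (K : set 'rV[R]_n) (f : 'rV[R]_n -> R) :
  compact K -> (forall x, ~ K x -> f x = 0) -> bounded_support f.
Proof.
move=> cK fK; have [M [_ KM]] := compact_bounded cK.
exists (M + 1) => x Mx; apply: fK => Kx; move: Mx; apply/negP; rewrite -leNgt.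
by apply: KM => //; rewrite ltrDl.
Qed.

Lemma integrable_bounded_support n (f : 'rV[R]_n -> R) :
  continuous f -> bounded_support f -> (mu n).-integrable setT (EFin \o f).
Proof.
move=> cf [M fM].
pose a : 'rV[R]_n := const_mx (- `|M|); pose b : 'rV[R]_n := const_mx `|M|.
pose B := [set v : V n | forall i, a 0 i <= (v : 'rV_n) 0 i <= b 0 i].
have BE : B = [set v : 'rV[R]_n | forall i, v ord0 i \in `[- `|M|, `|M|]].
  by apply/seteqP; split=> v Bv i; have := Bv i; rewrite !mxE in_itv.
have cB : compact B.
  rewrite BE; apply: (@rV_compact _ _ (fun=> `[- `|M|, `|M|]%classic)) => i.
  exact: segment_compact.
have mf : measurable_fun setT (f : V n -> measurableTypeR R).
  exact: continuous_measurable_fun_rV.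
have mB : measurable B.
  rewrite -(setCK B); apply: measurableC; apply: open_measurable_rV.
  by rewrite openC; exact: compact_closed.
have fB x : ~ B x -> f x = 0.
  move=> nBx; apply: fM; rewrite ltNge; apply/negP => xM; apply: nBx => i.
  rewrite !mxE -ler_norml (le_trans _ (ler_norm M))// (le_trans _ xM)//.
  exact: coord_le_norm.
rewrite (_ : EFin \o f = (EFin \o f) \_ B); last first.
  apply/funext => x; rewrite patchE; case: ifPn => // /negP.
  by rewrite inE => /fB /= ->.
apply: (iffLR (integrable_mkcond _ mB)).
apply: (@measurable_bounded_integrable _ (V n) R (mu n) f B) => //.
- rewrite [X in (X < _)%E]lebesgue_rV_box ?ltry// => i; rewrite !mxE.
  by rewrite ge0_cp// normr_ge0.
- exact: measurable_funTS.
- have : compact (f @` B).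
    by apply: continuous_compact cB; exact: continuous_subspaceT.
  move=> /compact_bounded[L [Lr LB]]; exists L; split=> // y Ly x Bx /=.
  by apply: (LB y Ly); exists x.
Qed.

(** Lebesgue measure in dimension [n.+1] is the image of a product measure;
    this transfers an integral to the product, where Fubini's theorem applies. *)
Lemma integral_lebesgue_rVS n (f : V n.+1 -> \bar R) :
  (mu n.+1).-integrable setT f ->
  ((@lebesgue_measure R) \x mu n)%E.-integrable setT (f \o @cons_rV R n) /\
  (\int[mu n.+1]_x f x =
     \int[(@lebesgue_measure R) \x mu n]_p f (cons_rV p))%E.
Proof.
move=> intf; have mf := measurable_int _ intf.
have mc := @measurable_cons_rV R n.
have intfc : ((@lebesgue_measure R) \x mu n)%E.-integrable setT (f \o @cons_rV R n).
  apply/integrableP; split; first exact: measurableT_comp.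
  move/integrableP : intf => [_]; apply: le_lt_trans.
  rewrite [leRHS](ge0_integral_pushforward mc)//.
  exact: measurableT_comp.
by split=> //; rewrite [LHS](integral_pushforward mc).
Qed.

Lemma integral_derive1_eq0 (F : R -> R) (M : R) :
  (forall t, derivable F t 1) -> continuous (F^`()%classic) ->
  (forall t, M < `|t| -> F t = 0) ->
  (\int[@lebesgue_measure R]_t (F^`()%classic t)%:E = 0)%E.
Proof.
move=> dF cF' FM.
have F'M t : M < `|t| -> F^`()%classic t = 0.
  move=> Mt; rewrite derive1E -(derive_cst (0 : R) t 1); apply: near_eq_derive.
  have oM : open [set s : R | M < `|s|].
    have := @open_comp _ _ (@Num.norm R R) [set s | M < s].
    by apply; [move=> s _; exact: norm_continuous | exact: open_gt].
  by apply: filterS (open_nbhs_nbhs (conj oM Mt)) => s /FM.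
(* beyond [|M|], so that [F] vanishes at both ends of [[-b, b]] *)
pose b : R := `|M| + 1.
have b0 : 0 < b by rewrite ltr_wpDl.
have Mb : M < b by rewrite /b (le_lt_trans (ler_norm _))// ltrDl.
have -> : (\int[@lebesgue_measure R]_t (F^`()%classic t)%:E)%E =
    (\int[@lebesgue_measure R]_(t in `[(- b)%R, b]) (F^`()%classic t)%:E)%E.
  rewrite [RHS]integral_mkcond; apply: eq_integral => t _; rewrite patchE.
  case: ifPn => // /negP; rewrite inE/= in_itv/= -ler_norml => /negP.
  by rewrite -ltNge => bt; rewrite F'M// (lt_trans Mb).
rewrite (@continuous_FTC2 _ _ F).
- by rewrite !FM ?subee// ?normrN (lt_le_trans Mb)// ler_norm.
- by rewrite (lt_trans _ b0)// oppr_lt0.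
- exact: continuous_subspaceT.
- have cF : continuous F.
    by move=> t; apply/differentiable_continuous/derivable1_diffP.
  split=> [t _| |]; first exact: dF.
    exact/cvg_at_right_filter/cF.
  exact/cvg_at_left_filter/cF.
- by [].
Qed.

Lemma cons_rV_head n (p : R * 'rV[R]_n) : cons_rV p 0 ord0 = p.1.
Proof. by have /(congr1 fst) := cons_rVK (p : _ * V n). Qed.

Lemma cons_rV_tail n (p : R * 'rV[R]_n) i :
  cons_rV p 0 (lift ord0 i) = p.2 0 i.
Proof.
have /(congr1 snd) /= E := cons_rVK (p : _ * V n).
rewrite -[in RHS]E [RHS]mxE; congr (fun_of_matrix (cons_rV p : 'rV_n.+1) _ _).
exact/val_inj.
Qed.

Lemma cons_rV_add_head n (t h : R) (w : 'rV[R]_n) :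
  cons_rV (h + t, w) = h *: delta_mx 0 ord0 + cons_rV (t, w) :> 'rV_n.+1.
Proof.
apply/rowP => i.
rewrite [RHS]mxE [X in _ = X + _]mxE [delta_mx _ _ _ _]mxE eqxx /=.
case: (unliftP ord0 i) => [j ->|->].
  by rewrite !cons_rV_tail mulr0 add0r.
by rewrite !cons_rV_head mulr1.
Qed.

Lemma cons_rV_add_tail n (t h : R) (w : 'rV[R]_n) j :
  cons_rV (t, h *: delta_mx 0 j + w) =
  h *: delta_mx 0 (lift ord0 j) + cons_rV (t, w) :> 'rV_n.+1.
Proof.
apply/rowP => i.
rewrite [RHS]mxE [X in _ = X + _]mxE [delta_mx _ _ _ _]mxE eqxx /=.
case: (unliftP ord0 i) => [k ->|->].
  by rewrite !cons_rV_tail /= !mxE eqxx (inj_eq lift_inj).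
by rewrite !cons_rV_head mulr0 add0r.
Qed.

Lemma continuous_cons_rV_head n (w : 'rV[R]_n) :
  continuous (fun t : R => cons_rV (t, w) : 'rV_n.+1).
Proof.
move=> t; rewrite (_ : (fun _ => _) =
    fun s => (s *: delta_mx 0 ord0 + cons_rV (0, w) : 'rV_n.+1)).
  by apply: cvgD; [apply: cvgZr_tmp; exact: cvg_id | exact: cvg_cst].
by apply/funext => s; rewrite -cons_rV_add_head addr0.
Qed.

Lemma continuous_cons_rV_tail n (t : R) :
  continuous (fun w : 'rV[R]_n => cons_rV (t, w) : 'rV_n.+1).
Proof.
move=> w; have FF : Filter (nbhs w) by exact: nbhs_filter.
apply/(@cvg_ballP _ _ _ (nbhs w)) => e e0; have := nbhsx_ballx w e e0.
apply: filterS => w' [_ ww']; split=> // i j; rewrite ord1.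
case: (unliftP ord0 j) => [k ->|->]; first by rewrite !cons_rV_tail.
by rewrite !cons_rV_head; exact: ballxx.
Qed.

Lemma norm_cons_rV n (t : R) (w : 'rV[R]_n) :
  `|t| <= `|cons_rV (t, w) : 'rV_n.+1| /\ `|w| <= `|cons_rV (t, w) : 'rV_n.+1|.
Proof.
split.
  by rewrite -[X in `|X| <= _](cons_rV_head (t, w)); exact: coord_le_norm.
rewrite [leLHS]/Num.norm /= mx_normrE; apply: bigmax_le => [//|[i j] _ /=].
by rewrite ord1 -(cons_rV_tail (t, w)); exact: coord_le_norm.
Qed.

Lemma partial_cons_rV_head n (f : 'rV[R]_n.+1 -> R) (w : 'rV[R]_n) (t : R) :
  let g s := f (cons_rV (s, w)) in
  (derivable f (cons_rV (t, w)) (delta_mx 0 ord0) -> derivable g t 1) /\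
  g^`()%classic t = partial ord0 f (cons_rV (t, w)).
Proof.
move=> g; rewrite derive1E /partial /derivable /derive.
set g1 := fun h => h^-1 *: _; set g2 := fun h => h^-1 *: _.
suff -> : g1 = g2 by [].
by apply/funext => h; rewrite /g1 /g2 /g /= [h%:A]mulr1 cons_rV_add_head.
Qed.

Lemma partial_cons_rV_tail n (f : 'rV[R]_n.+1 -> R) (t : R) (w : 'rV[R]_n) j :
  let g v := f (cons_rV (t, v)) in
  (derivable f (cons_rV (t, w)) (delta_mx 0 (lift ord0 j)) ->
     derivable g w (delta_mx 0 j)) /\
  partial j g w = partial (lift ord0 j) f (cons_rV (t, w)).
Proof.
move=> g; rewrite /partial /derivable /derive.
set g1 := fun h => h^-1 *: _; set g2 := fun h => h^-1 *: _.
suff -> : g1 = g2 by [].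
by apply/funext => h; rewrite /g1 /g2 /g /= cons_rV_add_tail.
Qed.

Lemma bounded_support_partial n i (f : 'rV[R]_n -> R) :
  bounded_support f -> bounded_support (partial i f).
Proof.
move=> [M fM]; exists M => x Mx.
have cM : closed [set y : 'rV[R]_n | `|y| <= M].
  apply: (@preimage_closed _ _ (fun y : 'rV[R]_n => `|y|) [set s | s <= M]).
    by move=> s _; exact: norm_continuous.
  exact: closed_le.
apply: (partial_vanish i cM); last by apply/negP; rewrite -ltNge.
by move=> y /negP; rewrite -ltNge; exact: fM.
Qed.

(** By induction on the dimension. A derivative in the first coordinate is
    integrated first along that coordinate, where the fundamental theorem of
    calculus gives 0; any other derivative is one of a section with the first
    coordinate fixed. *)
Lemma integral_partial_eq0 n i (f : 'rV[R]_n -> R) :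
  continuous f -> (forall x, derivable f x (delta_mx 0 i)) ->
  continuous (partial i f) -> bounded_support f ->
  (\int[mu n]_x (partial i f x)%:E = 0)%E.
Proof.
elim: n i f => [[]//|n IH] i f cf df cdf bf.
have intf := integrable_bounded_support cdf (bounded_support_partial i bf).
have [intfc ->] := integral_lebesgue_rVS intf.
have [M fM] := bf.
case: (unliftP ord0 i) => [j ij|i0]; rewrite ?ij ?i0 in df cdf intfc *.
  rewrite -integral12_prod_meas1//; apply: integral0_eq => t _ /=.
  rewrite -(IH j (fun w => f (cons_rV (t, w)))).
  - apply: eq_integral => w _ /=; congr EFin.
    by rewrite (partial_cons_rV_tail f t w j).2.
  - move=> w; apply: continuous_comp; [exact: continuous_cons_rV_tail|exact: cf].
  - by move=> w; exact/(partial_cons_rV_tail f t w j).1/df.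
  - rewrite (_ : partial _ _ =
        fun w => partial (lift ord0 j) f (cons_rV (t, w))); last first.
      by apply/funext => w; rewrite (partial_cons_rV_tail f t w j).2.
    move=> w; apply: continuous_comp; [exact: continuous_cons_rV_tail|exact: cdf].
  - exists M => w Mw; apply: fM; exact: lt_le_trans (norm_cons_rV t w).2.
rewrite -integral21_prod_meas1//; apply: integral0_eq => w _ /=.
pose g t := f (cons_rV (t, w)).
rewrite -(@integral_derive1_eq0 g M).
- apply: eq_integral => t _ /=; congr EFin.
  by rewrite (partial_cons_rV_head f w t).2.
- by move=> t; exact/(partial_cons_rV_head f w t).1/df.
- rewrite (_ : g^`()%classic = fun t => partial ord0 f (cons_rV (t, w))); last first.
    by apply/funext => t; rewrite (partial_cons_rV_head f w t).2.
  move=> t; apply: continuous_comp; [exact: continuous_cons_rV_head|exact: cdf].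
- move=> t Mt; apply: fM; exact: lt_le_trans (norm_cons_rV t w).1.
Qed.

End integration.

(** * Power means of distances *)

Lemma ler_powR_neg (R : realType) (r x y : R) : r <= 0 -> 0 < x -> x <= y ->
  y `^ r <= x `^ r.
Proof.
move=> r0 x0 xy; have y0 := lt_le_trans x0 xy; rewrite -(opprK r) !(powRN _ (- r)).
rewrite lef_pV2 ?posrE ?powR_gt0//.
by apply: ge0_ler_powR => //; rewrite ?nnegrE ?oppr_ge0// ltW.
Qed.

Section power_mean_distance.
Context (R : realType) (n : nat) (del p : R) (s : seq 'rV[R]_n).
Local Notation E := 'rV[R]_n.
Implicit Types (x y : E).

Definition sqdist y x : R := del + \sum_j (x 0 j - y 0 j) ^+ 2.

Definition power_sum x : R := \sum_(y <- s) sqdist y x `^ (- (p / 2)).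

(** For [p] large this is close to the minimum over [y] in [s] of
    [(del + |x - y|^2)^(1/2)]. *)
Definition power_mean x : R := power_sum x `^ (- p^-1).

Hypothesis del0 : 0 < del.
Hypothesis p0 : 0 < p.

Lemma sqdistE y x : sqdist y x = del + enorm (x - y) ^+ 2.
Proof.
by rewrite enorm_sqr; congr (_ + _); apply: eq_bigr => j _; rewrite !mxE.
Qed.

Lemma sqdist_gt0 y x : 0 < sqdist y x.
Proof. by rewrite sqdistE ltr_pwDl// sqr_ge0. Qed.

Lemma smooth_sqdist y : smooth (sqdist y).
Proof.
apply: smoothD; first exact: smooth_cst.
apply: smooth_sum => j; apply: smoothX2; apply: smoothD; last exact: smooth_cst.
exact: smooth_coord.
Qed.

Lemma partial_sqdist i y x : partial i (sqdist y) x = 2 * (x 0 i - y 0 i).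
Proof.
have sm j : smooth (fun x : E => x 0 j - y 0 j).
  by apply: smoothD; [exact: smooth_coord | exact: smooth_cst].
have sm2 j : smooth (fun x : E => (x 0 j - y 0 j) ^+ 2) by exact: smoothX2.
rewrite (partialD (f := fun=> del) _ _).2; last 2 first.
- exact: derivable_cst.
- by apply: smooth_derivable; exact: smooth_sum.
rewrite (partial_cst i del x).2 add0r partial_sum// (bigD1 i)//= big1 ?addr0.
  rewrite partialX2; last exact: smooth_derivable.
  rewrite (partialD _ _).2;
    [|exact: (partial_coord _ _ _).1|exact: derivable_cst].
  by rewrite (partial_coord _ _ _).2 (partial_cst _ _ _).2 eqxx addr0 mulr1.
move=> j ji; rewrite partialX2; last exact: smooth_derivable.
rewrite (partialD _ _).2;
    [|exact: (partial_coord _ _ _).1|exact: derivable_cst].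
rewrite (partial_coord _ _ _).2 (partial_cst _ _ _).2 eq_sym (negbTE ji).
by rewrite addr0 mulr0.
Qed.

Lemma smooth_power_sum : smooth power_sum.
Proof.
apply: smooth_sum => y; apply: smooth_powR; last exact: smooth_sqdist.
exact: sqdist_gt0.
Qed.

Lemma le_power_sum y x : y \in s -> sqdist y x `^ (- (p / 2)) <= power_sum x.
Proof.
by move=> ys; rewrite /power_sum (big_rem y ys)/= lerDl sumr_ge0// => *; exact: powR_ge0.
Qed.

Hypothesis s0 : s != [::].

Lemma power_sum_gt0 x : 0 < power_sum x.
Proof.
case: s s0 (le_power_sum) => // y s' _ /(_ y x); rewrite mem_head => /(_ isT).
by apply: lt_le_trans; rewrite powR_gt0// sqdist_gt0.
Qed.

Lemma power_mean_gt0 x : 0 < power_mean x.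
Proof. by rewrite powR_gt0// power_sum_gt0. Qed.

Lemma smooth_power_mean : smooth power_mean.
Proof. by apply: smooth_powR; [exact: power_sum_gt0 | exact: smooth_power_sum]. Qed.

Lemma power_mean_le y x : y \in s -> power_mean x <= sqdist y x `^ 2^-1.
Proof.
move=> ys; have -> : sqdist y x `^ 2^-1 = (sqdist y x `^ (- (p / 2))) `^ (- p^-1).
  by rewrite -powRrM; congr (_ `^ _); field; rewrite gt_eqF.
apply: ler_powR_neg; [|exact/powR_gt0/sqdist_gt0|exact: le_power_sum].
by rewrite oppr_le0 invr_ge0 ltW.
Qed.

Lemma power_mean_ge x (m : R) : 0 < m ->
  (forall y, y \in s -> m <= enorm (x - y)) ->
  (size s)%:R `^ (- p^-1) * m <= power_mean x.
Proof.
move=> m0 ms; have -> : m = ((m ^+ 2) `^ (- (p / 2))) `^ (- p^-1).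
  rewrite -powRrM (_ : _ * _ = 2^-1) ?powR12_sqrt ?sqr_ge0//; last first.
    by field; rewrite gt_eqF.
  by rewrite sqrtr_sqr gtr0_norm.
rewrite -powRM ?powR_ge0 ?ler0n//.
apply: ler_powR_neg; rewrite ?power_sum_gt0//.
  by rewrite oppr_le0 invr_ge0 ltW.
rewrite mulr_natl -iter_addr_0 -count_predT -big_const_seq /power_sum.
rewrite big_seq [leRHS]big_seq.
apply: ler_sum => y ys; apply: ler_powR_neg; rewrite ?exprn_gt0//.
  by rewrite oppr_le0 divr_ge0// ltW.
rewrite sqdistE ler_wpDl ?(ltW del0)//.
by rewrite ler_pXn2r ?nnegrE ?enorm_ge0 ?(ltW m0) ?ms.
Qed.

(** The gradient is a combination of the vectors [x - y] with nonnegative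
    coefficients, which is what makes the bound by 1 possible. *)
Lemma gradient_power_mean x : gradient power_mean x =
  \sum_(y <- s)
    (power_sum x `^ (- p^-1 - 1) * sqdist y x `^ (- (p / 2) - 1)) *: (x - y).
Proof.
apply/rowP => i; rewrite mxE summxE.
rewrite (partial_powR _ (power_sum_gt0 x) _).2; last first.
  exact/smooth_derivable/smooth_power_sum.
rewrite partial_sum; last first.
  move=> y; apply: smooth_powR; [exact: sqdist_gt0 | exact: smooth_sqdist].
rewrite mulr_sumr; apply: eq_bigr => y _.
rewrite (partial_powR _ (sqdist_gt0 y x) _).2; last exact/smooth_derivable/smooth_sqdist.
rewrite partial_sqdist !mxE.
by field; rewrite gt_eqF.
Qed.

(** With [q_y = del + |x - y|^2] and [S = sum_y q_y^(-p/2)], one has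
    [|x - y| <= q_y^(1/2)] and [q_y^(-1/2) <= S^(1/p)]; hence the norm of the
    gradient is at most
    [S^(-1/p - 1) sum_y q_y^(-p/2 - 1/2) <= S^(-1) sum_y q_y^(-p/2) = 1]. *)
Lemma enorm_gradient_power_mean x : enorm (gradient power_mean x) <= 1.
Proof.
rewrite gradient_power_mean; apply: le_trans (enorm_sum _ _) _.
set S := power_sum x; have S0 : 0 < S := power_sum_gt0 x.
rewrite [leRHS](_ : 1 = \sum_(y <- s)
    S `^ (- p^-1 - 1) * (S `^ p^-1 * sqdist y x `^ (- (p / 2)))); last first.
  rewrite -!mulr_sumr -/(power_sum x) -/S mulrA -powRD; last first.
    by rewrite (gt_eqF S0) implybT.
  rewrite -[X in _ * X](powRr1 (ltW S0)) -powRD ?(gt_eqF S0) ?implybT//.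
  by rewrite (_ : _ + _ + _ + _ = 0) ?powRr0//; ring.
rewrite big_seq [leRHS]big_seq; apply: ler_sum => y ys.
set q := sqdist y x; have q0 : 0 < q := sqdist_gt0 y x.
rewrite enormZ ger0_norm ?mulr_ge0 ?powR_ge0// -mulrA ler_wpM2l ?powR_ge0//.
have xyq : enorm (x - y) <= q `^ 2^-1.
  rewrite powR12_sqrt ?(ltW q0)// -[leLHS]ger0_norm ?enorm_ge0// -sqrtr_sqr.
  by rewrite ler_wsqrtr// /q sqdistE lerDr ltW.
have qS : q `^ (- 2^-1) <= S `^ p^-1.
  have -> : q `^ (- 2^-1) = (q `^ (- (p / 2))) `^ p^-1.
    by rewrite -powRrM; congr (_ `^ _); field; rewrite gt_eqF.
  apply: ge0_ler_powR; rewrite ?nnegrE ?powR_ge0 ?invr_ge0 ?(ltW p0) ?(ltW S0)//.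
  exact: le_power_sum.
apply: le_trans (ler_wpM2l (powR_ge0 _ _) xyq) _.
rewrite (_ : q `^ _ * _ = q `^ (- 2^-1) * q `^ (- (p / 2))); last first.
  by rewrite -!powRD ?(gt_eqF q0) ?implybT//; congr (_ `^ _); field.
by rewrite ler_wpM2r ?powR_ge0.
Qed.

End power_mean_distance.

(** * Smooth approximation of the distance to the boundary *)

Section distance_approximation.
Context (R : realType) (n : nat) (Om : set 'rV[R]_n).
Local Notation E := 'rV[R]_n.
Local Notation d := (boundary_dist Om).
Hypothesis dOm : is_domain Om.
Hypothesis OmT : Om <> setT.

Lemma boundary_dist_min (K : set E) : compact K -> K `<=` Om ->
  exists2 m : R, 0 < m & forall x, K x -> m <= d x.
Proof.
move=> cK KOm; have [->|/set0P K0] := eqVneq K set0; first by exists 1.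
have [|c /[!inE] Kc cmin] := compact_EVT_min (f := d) K0 cK.
  by apply: continuous_subspaceT; exact: continuous_boundary_dist.
exists (d c) => [|x Kx]; last by apply: cmin; rewrite inE.
by apply: boundary_dist_gt0 => //; exact: KOm.
Qed.

(** Each point [x] of [K] has a boundary point at distance less than
    [(1 + e) d x], and the same boundary point serves all nearby points.
    Compactness leaves finitely many of them; one more is added so that the
    list is nonempty even if [K] is empty. *)
Lemma boundary_dist_net (K : set E) (e : R) :
  compact K -> K `<=` Om -> 0 < e ->
  exists s : seq E, [/\ s != [::], forall y, y \in s -> boundary Om y &
    forall x, K x -> exists2 y, y \in s & enorm (x - y) <= (1 + e) * d x].
Proof.
move=> cK KOm e0.
pose f (y : E) := [set x : E | 0 < (1 + e) * d x - enorm (x - y)].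
have of_ y : open (f y).
  have cd : continuous (fun x => (1 + e) * d x).
    move=> x; apply: (@continuousM _ _ (fun=> 1 + e) d); first exact: cst_continuous.
    exact: continuous_boundary_dist.
  have cn : continuous (fun x : E => enorm (x - y)) by exact: continuous_enormB.
  apply: (@open_comp _ _ (fun x : E => (1 + e) * d x - enorm (x - y)) [set t | 0 < t]).
    by move=> x _; exact: (continuousB (cd x) (cn x)).
  exact: open_gt.
have Kf : K `<=` cover (boundary Om) f.
  move=> x Kx; have dx : 0 < d x by apply: boundary_dist_gt0 => //; exact: KOm.
  have [|y by_ xy] := @boundary_dist_lt _ _ _ dOm OmT x ((1 + e) * d x).
    by rewrite ltr_pMl// ltrDl.
  by exists y => //; rewrite /f /= subr_gt0.
have [y0 by0] := boundary_nonempty dOm OmT.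
move: cK; rewrite compact_cover => /(_ _ _ _ (fun i _ => of_ i) Kf)[D DB KD].
exists (y0 :: finmap.enum_fset D); split=> // [y|x /KD[y /= yD fxy]].
  rewrite inE => /predU1P[->//|yD].
  by have := DB y yD; rewrite inE.
by exists y; [rewrite inE; apply/orP; right | rewrite ltW// -subr_gt0].
Qed.

(** The upper bound combines a net that is accurate up to the factor
    [1 + e / 2] with a shift [del] so small that it costs at most [e / 2] times
    a positive lower bound of [d] on [K]. In the lower bound the number of
    points of the net enters as [(size s)^(-1/p)], which tends to 1 as [p]
    grows. *)
Lemma smooth_boundary_dist (K : set E) (e : R) :
  compact K -> K `<=` Om -> 0 < e ->
  exists h : E -> R, [/\ smooth h, forall x, 0 < h x,
    forall x, enorm (gradient h x) <= 1 &
    forall x, K x -> (1 - e) * d x <= h x <= (1 + e) * d x].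
Proof.
move=> cK KOm e0; have e20 : 0 < e / 2 by rewrite divr_gt0.
have [m m0 Km] := boundary_dist_min cK KOm.
have [s [s0 bs Ks]] := boundary_dist_net cK KOm e20.
have L1 : 1 <= (size s)%:R :> R by rewrite ler1n lt0n size_eq0.
set L : R := (size s)%:R in L1 *.
(* chosen so that [ln L / p <= e], hence [L^(-1/p) >= 1 - e] *)
pose p := ln L / e + 1.
have p0 : 0 < p by rewrite ltr_wpDl// divr_ge0 ?ln_ge0// ltW.
pose del := (e / 2 * m) ^+ 2.
have del0 : 0 < del by rewrite exprn_gt0// mulr_gt0.
exists (power_mean del p s); split.
- exact: smooth_power_mean.
- by move=> x; exact: power_mean_gt0.
- by move=> x; exact: enorm_gradient_power_mean.
move=> x Kx; have dx : 0 < d x by apply: boundary_dist_gt0 => //; exact: KOm.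
apply/andP; split.
  apply: (@le_trans _ _ (L `^ (- p^-1) * d x)); last first.
    apply: power_mean_ge => // y ys; apply: boundary_dist_le => //; exact: bs.
  rewrite ler_pM2r//; apply: (@le_trans _ _ (expR (- (ln L / p)))).
    apply: le_trans (expR_ge1Dx _); rewrite lerD2l lerN2 ler_pdivrMr//.
    by rewrite /p mulrDr mulr1 mulrCA divff ?gt_eqF// mulr1 lerDl ltW.
  by rewrite /powR gt_eqF ?(lt_le_trans ltr01)// mulNr mulrC.
have [y ys xy] := Ks x Kx.
apply: le_trans (power_mean_le del0 p0 x ys) _.
have xy0 := enorm_ge0 (x - y).
have em0 : 0 <= e / 2 * m by rewrite mulr_ge0// ltW.
apply: (@le_trans _ _ (enorm (x - y) + e / 2 * m)).
  rewrite powR12_sqrt; last by rewrite sqdistE addr_ge0// ?sqr_ge0// ltW.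
  rewrite -[leRHS]ger0_norm ?addr_ge0// -sqrtr_sqr ler_wsqrtr// sqdistE sqrrD.
  rewrite [leRHS]addrC lerD2l// lerDl.
  by rewrite mulrn_wge0// mulr_ge0.
have := ler_wpM2l (ltW e20) (Km x Kx).
by move: xy; set D := d x; set a := enorm _; nra.
Qed.

End distance_approximation.

(** * Integrals of functions supported in a compact set *)

Section compactly_supported_integrals.
Context (R : realType) (n : nat) (Om K : set 'rV[R]_n).
Local Notation E := 'rV[R]_n.
Local Notation mu := (lebesgue_rV R n).
Implicit Types f g : E -> R.
Hypothesis oOm : open Om.
Hypothesis cK : compact K.
Hypothesis KOm : K `<=` Om.

(** The integrands of the energies are all of this form, which the operations
    below preserve and which implies integrability over [Om]. *)
Definition supported f := continuous f /\ forall x, ~ K x -> f x = 0.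

Definition integral_on f : R := Rintegral mu Om (f : borel_rV R n -> R).

Lemma supportedD f g : supported f -> supported g ->
  supported (fun x => f x + g x).
Proof.
move=> [cf fK] [cg gK]; split=> x; last by move=> Kx; rewrite fK// gK// addr0.
exact: (continuousD (cf x) (cg x)).
Qed.

Lemma supportedM f g : continuous f -> supported g ->
  supported (fun x => f x * g x).
Proof.
move=> cf [cg gK]; split=> x; last by move=> Kx; rewrite gK// mulr0.
exact: (continuousM (cf x) (cg x)).
Qed.

Lemma supportedZ (c : R) f : supported f -> supported (fun x => c * f x).
Proof. by apply: supportedM; exact: cst_continuous. Qed.

Lemma supported_sum (I : Type) (s : seq I) (F : I -> E -> R) :
  (forall i, supported (F i)) -> supported (fun x => \sum_(i <- s) F i x).
Proof.
move=> sF; split; first by apply: continuous_sum => i; exact: (sF i).1.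
by move=> x Kx; rewrite big1// => i _; exact: (sF i).2.
Qed.

Lemma measurable_domain : measurable (Om : set (borel_rV R n)).
Proof. exact: open_measurable_rV. Qed.

Lemma supported_integrable f : supported f ->
  mu.-integrable (Om : set (borel_rV R n)) (EFin \o (f : borel_rV R n -> R)).
Proof.
move=> [cf fK].
apply: (@integrableS _ _ _ mu setT) => //; first exact: measurable_domain.
by apply: integrable_bounded_support => //; exact: compact_bounded_support fK.
Qed.

Lemma integral_onE f : supported f ->
  (\int[mu]_(x in Om) (f x)%:E)%E = (integral_on f)%:E.
Proof.
move=> sf; rewrite /integral_on /Rintegral fineK//.
by apply: integrable_fin_num; [exact: measurable_domain | exact: supported_integrable].
Qed.

Lemma integral_onD f g : supported f -> supported g ->
  integral_on (fun x => f x + g x) = integral_on f + integral_on g.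
Proof.
move=> sf sg; apply: RintegralD; first exact: measurable_domain.
  exact: supported_integrable.
exact: supported_integrable.
Qed.

Lemma integral_onZ (c : R) f : supported f ->
  integral_on (fun x => c * f x) = c * integral_on f.
Proof.
by move=> sf; apply: RintegralZl;
  [exact: measurable_domain | exact: supported_integrable].
Qed.

Lemma le_integral_on f g : supported f -> supported g ->
  (forall x, Om x -> f x <= g x) -> integral_on f <= integral_on g.
Proof.
move=> sf sg fg; apply: le_Rintegral; first exact: measurable_domain.
- exact: supported_integrable.
- exact: supported_integrable.
- by [].
Qed.

Lemma supported_partial i f : smooth f -> (forall x, ~ K x -> f x = 0) ->
  supported (partial i f).
Proof.
move=> sf fK; split; first exact/smooth_continuous/smooth_partial.
by apply: partial_vanish => //; exact: compact_closed.
Qed.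

(** The divergence theorem, without boundary term since the field has
    compact support in [Om]. *)
Lemma integral_on_divergence (F : 'I_n -> E -> R) :
  (forall i, smooth (F i)) -> (forall i x, ~ K x -> F i x = 0) ->
  integral_on (fun x => \sum_i partial i (F i) x) = 0.
Proof.
move=> sF FK; have sup i := supported_partial i (sF i) (FK i).
have int0 i : integral_on (partial i (F i)) = 0.
  apply: EFin_inj; rewrite -integral_onE// integral_mkcond.
  transitivity (\int[mu]_x (partial i (F i) x)%:E)%E.
    apply: eq_integral => x _; rewrite patchE; case: ifPn => // /negP.
    by rewrite inE => Omx; rewrite (sup i).2// => /KOm.
  apply: integral_partial_eq0.
  - exact: smooth_continuous.
  - by move=> x; exact: smooth_derivable.
  - exact: (sup i).1.
  - exact: compact_bounded_support (FK i).
elim: (index_enum _) => [|i s IH].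
  under [X in integral_on X]eq_fun do rewrite big_nil.
  by rewrite /integral_on Rintegral_cst ?mul0r//; exact: measurable_domain.
under [X in integral_on X]eq_fun do rewrite big_cons.
by rewrite integral_onD// ?int0 ?IH ?addr0//; exact: supported_sum.
Qed.

End compactly_supported_integrals.

(** * The substitution u = h^(1/2) v *)

Section ground_state.
Context (R : realType) (n : nat).
Local Notation E := 'rV[R]_n.
Implicit Types (f h u v w : E -> R) (x : E).

Lemma enorm_gradient_sqr u x :
  enorm (gradient u x) ^+ 2 = \sum_i partial i u x ^+ 2.
Proof. by rewrite enorm_sqr; apply: eq_bigr => i _; rewrite mxE. Qed.

Lemma smooth_enorm_gradient_sqr u : smooth u ->
  smooth (fun x => enorm (gradient u x) ^+ 2).
Proof.
move=> su; under eq_fun do rewrite enorm_gradient_sqr.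
by apply: smooth_sum => i; apply: smoothX2; exact: smooth_partial.
Qed.

Lemma smooth_laplacian u : smooth u -> smooth (laplacian u).
Proof. by move=> su; apply: smooth_sum => i; do 2!apply: smooth_partial. Qed.

Lemma divergence_mul_gradient h w x : smooth h -> smooth w ->
  \sum_i partial i (fun y => h y * partial i w y) x =
  \sum_i partial i h x * partial i w x + h x * laplacian w x.
Proof.
move=> sh sw; rewrite mulr_sumr -big_split; apply: eq_bigr => i _ /=.
rewrite (partialM _ _).2; [|exact: smooth_derivable|].
  by rewrite addrC; congr (_ + _); exact: mulrC.
by apply: smooth_derivable; exact: smooth_partial.
Qed.

(** Expand [grad u = h^(1/2) grad v + 1/2 v h^(-1/2) grad h]. The cross term
    [v grad v . grad h] equals [1/2 grad(v^2) . grad h], which is written as a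
    divergence minus [1/2 h Lap(v^2)] so that it integrates without
    derivatives of [h]. *)
Lemma ground_state_identity h v x : smooth h -> (forall y, 0 < h y) -> smooth v ->
  enorm (gradient (fun y => h y `^ 2^-1 * v y) x) ^+ 2 =
  h x * enorm (gradient v x) ^+ 2
  + 2^-1 * \sum_i partial i (fun y => h y * partial i (fun z => v z ^+ 2) y) x
  - 2^-1 * (h x * laplacian (fun y => v y ^+ 2) x)
  + 4^-1 * (v x ^+ 2 * (enorm (gradient h x) ^+ 2 / h x)).
Proof.
move=> sh h0 sv; rewrite divergence_mul_gradient//; last exact: smoothX2.
rewrite mulrDr !addrA addrK !enorm_gradient_sqr.
rewrite mulr_sumr mulr_suml !mulr_sumr -!big_split /=; apply: eq_bigr => i _.
rewrite partialX2; last exact: smooth_derivable.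
rewrite (partialM _ _).2; [|exact/smooth_derivable/smooth_powR|exact: smooth_derivable].
rewrite (partial_powR _ (h0 x) _).2; last exact: smooth_derivable.
set r := h x `^ 2^-1; have r0 : 0 < r by rewrite powR_gt0.
have hr : h x = r ^+ 2.
  by rewrite /r powR12_sqrt ?sqr_sqrtr// ltW.
have -> : h x `^ (2^-1 - 1) = r^-1.
  by rewrite /r -powRN; congr (_ `^ _); field.
by rewrite hr; field; rewrite gt_eqF.
Qed.

End ground_state.

(** Here [d], [h], [g], [P], [L], [w], [q] stand for the values at a point of
    the distance, its approximation, [|grad v|^2], the divergence of
    [h grad(v^2)], the Laplacian of [v^2], [v^2] and [|grad h|]; [m] is a lower
    bound of the distance. Replacing [h] by [d] in the terms with [g] and [L]
    costs a relative error [e]. The two terms with [w] cancel up to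
    [3/4 e w / m], because [1 / (1 - e) - (1 - e) <= 3 e] for [e <= 1/2]. *)
Lemma pointwise_bound (R : realType) (d h m e g P L w q : R) :
  0 < e -> e <= 2^-1 -> 0 < m -> m <= d -> (1 - e) * d <= h <= (1 + e) * d ->
  0 <= g -> 0 <= w -> 0 <= q -> q <= 1 ->
  h * g + 2^-1 * P - 2^-1 * (h * L) + 4^-1 * (w * (q ^+ 2 / h))
    - 4^-1 * (h * w / d ^+ 2)
  <= d * g + 2^-1 * P - 2^-1 * (d * L)
     + e * (d * g + 2^-1 * (d * `|L|) + 3 / 4 / m * w).
Proof.
move=> e0 e2 m0 md /andP[h1 h2] g0 w0 q0 q1.
have d0 : 0 < d := lt_le_trans m0 md.
have h0 : 0 < h by apply: lt_le_trans h1; rewrite mulr_gt0// subr_gt0; lra.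
have H1 : h * g <= (1 + e) * d * g by rewrite ler_wpM2r.
have H2 : (d - h) * L <= e * d * `|L|.
  apply: le_trans (ler_norm _) _; rewrite normrM ler_wpM2r// ler_norml.
  by apply/andP; split; lra.
have H3 : q ^+ 2 / h - h / d ^+ 2 <= 3 * e / m.
  apply: (@le_trans _ _ (((1 - e) * d)^-1 - (1 - e) * d / d ^+ 2)).
    apply: lerB; last by rewrite ler_wpM2r// invr_ge0 sqr_ge0.
    apply: (@le_trans _ _ h^-1).
      by rewrite ler_piMl ?invr_ge0 ?(ltW h0)// expr_le1.
    by rewrite lef_pV2// posrE// mulr_gt0// subr_gt0; lra.
  apply: (@le_trans _ _ (3 * e / d)); last first.
    by rewrite ler_wpM2l ?mulr_ge0 ?(ltW e0)// lef_pV2// posrE.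
  rewrite -subr_ge0 (_ : _ - _ = (e * (1 - 2 * e)) / ((1 - e) * d)); last first.
    by field; rewrite !gt_eqF//; lra.
  by rewrite divr_ge0// mulr_ge0//; lra.
have H4 := ler_wpM2l w0 H3.
rewrite -subr_ge0.
have -> : d * g + 2^-1 * P - 2^-1 * (d * L)
     + e * (d * g + 2^-1 * (d * `|L|) + 3 / 4 / m * w) -
  (h * g + 2^-1 * P - 2^-1 * (h * L) + 4^-1 * (w * (q ^+ 2 / h))
    - 4^-1 * (h * w / d ^+ 2)) =
  ((1 + e) * d * g - h * g) + 2^-1 * (e * d * `|L| - (d - h) * L)
  + 4^-1 * (w * (3 * e / m) - w * (q ^+ 2 / h - h / d ^+ 2)).
  by field; rewrite !gt_eqF.
by rewrite 2?addr_ge0// ?subr_ge0// mulr_ge0 ?subr_ge0.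
Qed.

Lemma test_functionM (R : realType) n (Om : set 'rV[R]_n) (h v : 'rV[R]_n -> R) :
  smooth h -> test_function Om v -> test_function Om (fun x => h x * v x).
Proof.
move=> sh [sv cv vOm].
have hv : support_closure (fun x => h x * v x) `<=` support_closure v.
  apply: closureS => x /=; apply: contra_neq => ->; exact: mulr0.
split; first exact: smoothM.
  by apply: subclosed_compact cv hv; exact: closed_closure.
exact: subset_trans vOm.
Qed.

Lemma support_closure_vanish (R : realType) n (v : 'rV[R]_n -> R) x :
  ~ support_closure v x -> v x = 0.
Proof. by move=> nx; apply: contra_notP nx => /eqP vx; exact: subset_closure. Qed.

(** * The inequality up to a vanishing error *)

(** The value [e = 1/2] already shows that [Y] is finite. *)
Lemma lee_vanishing_error (R : realType) (C X Z : R) (Y : \bar R) :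
  0 < C -> (0 <= Y)%E ->
  (forall e : R, 0 < e -> e <= 2^-1 ->
     (C%:E * ((1 - e)%:E * Y) <= (X + e * Z)%:E)%E) ->
  (C%:E * Y <= X%:E)%E.
Proof.
move=> C0 Y0 bound; case: Y Y0 bound => [r| |//] Y0 bound; last first.
  have := bound 2^-1; rewrite invr_gt0 ltr0n lexx => /(_ isT isT).
  by rewrite gt0_muley ?lte_fin ?subr_gt0 ?invf_lt1 ?ltr1n// gt0_muley ?lte_fin.
rewrite -EFinM lee_fin; apply/ler_addgt0Pr => eps eps0.
set M := `|Z + C * r| + 1; have M0 : 0 < M by rewrite ltr_wpDl.
pose e := Num.min 2^-1 (eps / M).
have e0 : 0 < e by rewrite lt_min invr_gt0 ltr0n divr_gt0.
have := bound e e0; rewrite ge_min lexx => /(_ isT).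
rewrite -!EFinM lee_fin => be.
have : e * (Z + C * r) <= eps.
  apply: (@le_trans _ _ (e * M)).
    by rewrite ler_pM2l// (le_trans (ler_norm _))// lerDl.
  by rewrite -ler_pdivlMr// ge_min lexx orbT.
by lra.
Qed.

Section hardy_sobolev_mazya_weighted.
Context (R : realType) (N : nat) (Om : set 'rV[R]_N) (C : R).
Local Notation E := 'rV[R]_N.
Local Notation mu := (lebesgue_rV R N).
Local Notation d := (boundary_dist Om).
Local Notation p := (sobolev_exponent R N).
Hypothesis dOm : is_domain Om.
Hypothesis OmT : Om <> setT.
Variable v : E -> R.
Hypothesis hv : test_function Om v.
Local Notation K := (support_closure v).
Local Notation w := (fun x => v x ^+ 2).

Let cd : continuous d. Proof. exact: continuous_boundary_dist. Qed.
Let sv : smooth v. Proof. by case: hv. Qed.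
Let cK : compact K. Proof. by case: hv. Qed.
Let KOm : K `<=` Om. Proof. by case: hv. Qed.
Let oOm : open Om. Proof. by case: dOm. Qed.
Let sw : smooth w. Proof. exact: smoothX2. Qed.
Let wK x : ~ K x -> w x = 0.
Proof. by move=> /support_closure_vanish ->; rewrite expr0n. Qed.
Let clK : closed K. Proof. exact: closed_closure. Qed.

Definition weighted_energy x : R := d x * enorm (gradient v x) ^+ 2.

Lemma supported_enorm_gradient_sqr u : smooth u -> (forall x, ~ K x -> u x = 0) ->
  supported K (fun x => enorm (gradient u x) ^+ 2).
Proof.
move=> su uK; split; first exact/smooth_continuous/smooth_enorm_gradient_sqr.
move=> x Kx; rewrite enorm_gradient_sqr big1// => i _.
by rewrite (partial_vanish i clK uK)// expr0n.
Qed.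

Lemma supported_laplacian_sqr : supported K (laplacian w).
Proof.
split; first exact/smooth_continuous/smooth_laplacian.
move=> x Kx; rewrite /laplacian big1// => i _.
by apply: (partial_vanish i clK) => // y; exact: partial_vanish.
Qed.

Lemma supported_weighted_energy : supported K weighted_energy.
Proof.
apply: supportedM => //; apply: supported_enorm_gradient_sqr => //.
exact: support_closure_vanish.
Qed.

Lemma integral_dist_laplacian_ge0 : dist_subharmonic Om ->
  0 <= integral_on Om (fun x => d x * laplacian w x).
Proof.
move=> subh.
have tw : test_function Om w.
  by under eq_fun do rewrite expr2; exact: test_functionM.
have := subh _ tw (fun x => sqr_ge0 (v x)).
rewrite (integral_onE oOm cK) ?lee_fin//.
by apply: supportedM => //; exact: supported_laplacian_sqr.
Qed.

(** The function [u] is [h^(1/2) v], with [h] the approximation of [d] of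
    accuracy [e]. The constant [Z] must not depend on [e]: it is the integral of
    [d |grad v|^2 + 1/2 d |Lap(v^2)| + 3/4 v^2 / m], with [m] a positive lower
    bound of [d] on the support of [v]. *)
Lemma perturbed_hsm : hardy_sobolev_mazya Om C -> dist_subharmonic Om ->
  exists Z : R, forall e : R, 0 < e -> e <= 2^-1 ->
  exists u : E -> R,
    [/\ smooth u, forall x, ~ K x -> u x = 0,
        forall x, K x -> ((1 - e) * d x) `^ 2^-1 * `|v x| <= `|u x| &
    (C%:E * (\int[mu]_(x in Om) (`|u x| `^ p)%:E) `^ ((N%:R - 2) / N%:R)%R
       <= (integral_on Om weighted_energy + e * Z)%:E)%E].
Proof.
move=> hsm subh.
have [m m0 Km] := boundary_dist_min dOm OmT cK KOm.
pose err x := d x * enorm (gradient v x) ^+ 2 + 2^-1 * (d x * `|laplacian w x|)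
  + 3 / 4 / m * w x.
have sup_w : supported K w by split; [exact: smooth_continuous | exact: wK].
have sup_L := supported_laplacian_sqr.
have sup_dL : supported K (fun x => d x * laplacian w x) by exact: supportedM.
have sup_aL : supported K (fun x => d x * `|laplacian w x|).
  apply: supportedM => //; split=> x; last by move=> /sup_L.2 ->; rewrite normr0.
  by apply: continuous_comp; [exact: sup_L.1 | exact: norm_continuous].
have sup_err : supported K err.
  apply: supportedD; last exact: supportedZ.
  by apply: supportedD; [exact: supported_weighted_energy | exact: supportedZ].
exists (integral_on Om err) => e e0 e2.
have [h [sh h0 gh hd]] := smooth_boundary_dist dOm OmT cK KOm e0.
pose u x := h x `^ 2^-1 * v x.
have su : smooth (fun x => h x `^ 2^-1) by exact: smooth_powR.
have tu : test_function Om u by exact: test_functionM.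
have uK x : ~ K x -> u x = 0.
  by move=> /support_closure_vanish vx; rewrite /u vx mulr0.
exists u; split => //; first by case: tu.
  move=> x Kx; have /andP[hl _] := hd x Kx.
  rewrite /u normrM [`|_ `^ _|]ger0_norm ?powR_ge0// ler_wpM2r//.
  have dx := boundary_dist_ge0 dOm OmT x.
  by apply: ge0_ler_powR; rewrite ?nnegrE ?invr_ge0 ?(ltW (h0 x)) ?mulr_ge0//; lra.
apply: le_trans (hsm _ tu) _.
(* On the support of [v] this is [d], but it never vanishes, so that dividing
   by it gives a continuous function on the whole space. *)
pose dm x := Num.max (d x) m.
have dm0 x : 0 < dm x by rewrite lt_max m0 orbT.
have cdm : continuous dm.
  by move=> y; apply: continuous_max; [exact: cd | exact: cst_continuous].
have cdm2 : continuous (fun x => dm x ^+ 2).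
  by under eq_fun do rewrite expr2; move=> y; exact: (continuousM (cdm y) (cdm y)).
have sup_u2 : supported K (fun x => (h x / dm x ^+ 2) * w x).
  have cV : continuous (fun x => (dm x ^+ 2)^-1).
    by move=> x; apply: (continuousV _ (cdm2 x)); rewrite expf_neq0// gt_eqF.
  have ch : continuous h by exact: smooth_continuous.
  by apply: supportedM => // x; exact: (continuousM (ch x) (cV x)).
have [smu _ _] := tu; have sup_gu := supported_enorm_gradient_sqr smu uK.
have -> : (\int[mu]_(x in Om) (`|u x| ^+ 2 / d x ^+ 2)%:E)%E =
    (integral_on Om (fun x => (h x / dm x ^+ 2) * w x))%:E.
  rewrite -(integral_onE oOm cK)//; apply: eq_integral => x _; congr EFin.
  rewrite real_normK ?num_real// /u exprMn powR12_sqrt ?(ltW (h0 x))//.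
  rewrite sqr_sqrtr ?(ltW (h0 x))//.
  have [Kx|Kx] := pselect (K x); last first.
    by rewrite (support_closure_vanish Kx) expr0n !mulr0 mul0r.
  by rewrite /dm (max_idPl (Km x Kx)); ring.
rewrite (integral_onE oOm cK)// -EFinM -EFinB lee_fin.
pose div x := \sum_i partial i (fun y => h y * partial i w y) x.
have sF i : smooth (fun y => h y * partial i w y).
  by apply: smoothM => //; exact: smooth_partial.
have FK i x : ~ K x -> h x * partial i w x = 0.
  by move=> Kx; rewrite (partial_vanish i clK wK Kx) mulr0.
have sup_div : supported K div.
  by apply: supported_sum => i; exact: (supported_partial cK i (sF i) (FK i)).
have div0 : integral_on Om div = 0 by exact: (integral_on_divergence oOm cK KOm sF FK).
have sup_G := supported_weighted_energy.
have sup1 := supportedZ 2^-1 sup_div.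
have sup2 := supportedZ (- 2^-1) sup_dL.
have sup3 := supportedZ e sup_err.
have sup23 := supportedD sup2 sup3.
have sup123 := supportedD sup1 sup23.
have E2 : integral_on Om (fun x => weighted_energy x +
    (2^-1 * div x + ((- 2^-1) * (d x * laplacian w x) + e * err x))) =
    integral_on Om weighted_energy - 2^-1 * integral_on Om (fun x => d x * laplacian w x)
      + e * integral_on Om err.
  rewrite (integral_onD oOm cK sup_G sup123) (integral_onD oOm cK sup1 sup23).
  rewrite (integral_onD oOm cK sup2 sup3) (integral_onZ oOm cK _ sup_div).
  rewrite (integral_onZ oOm cK _ sup_dL) (integral_onZ oOm cK _ sup_err) div0.
  by ring.
have sup4 := supportedZ (- 4^-1) sup_u2.
rewrite -mulNr -(integral_onZ oOm cK _ sup_u2) -(integral_onD oOm cK sup_gu sup4).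
apply: (@le_trans _ _ (integral_on Om weighted_energy
    - 2^-1 * integral_on Om (fun x => d x * laplacian w x)
    + e * integral_on Om err)).
  rewrite -E2; apply: (le_integral_on oOm cK).
  - exact: supportedD sup_gu sup4.
  - exact: supportedD sup_G sup123.
  move=> x Omx.
  have [Kx|Kx] := pselect (K x); last first.
    rewrite (sup_gu.2 x Kx) (sup_u2.2 x Kx) (sup_div.2 x Kx) (sup_dL.2 x Kx).
    by rewrite (sup_err.2 x Kx) (sup_G.2 x Kx); lra.
  rewrite ground_state_identity// -/(div x) /dm (max_idPl (Km x Kx)).
  have := @pointwise_bound R (d x) (h x) m e (enorm (gradient v x) ^+ 2) (div x)
    (laplacian w x) (w x) (enorm (gradient h x)) e0 e2 m0 (Km x Kx) (hd x Kx)
    (sqr_ge0 _) (sqr_ge0 _) (enorm_ge0 _) (gh x).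
  by rewrite /weighted_energy /err; lra.
have := integral_dist_laplacian_ge0 subh; lra.
Qed.

End hardy_sobolev_mazya_weighted.

(** * The conformal metric *)

Section conformal_quantities.
Context (R : realType) (N : nat) (Om : set 'rV[R]_N).
Local Notation d := (boundary_dist Om).
Local Notation A := (dist_factor Om).
Local Notation p := (sobolev_exponent R N).
Hypothesis N3 : (3 <= N)%N.

Lemma dimension_gt2 : 0 < N%:R - 2 :> R.
Proof. by rewrite subr_gt0 ltr_nat. Qed.

Let N2 := dimension_gt2.
Let N0 : 0 < N%:R :> R. Proof. by rewrite ltr0n; case: N N3. Qed.

Lemma dist_factor_volume x : A x ^+ N = d x `^ (2^-1 * p).
Proof.
rewrite -powR_mulrn ?powR_ge0// -powRrM; congr (_ `^ _).
by rewrite /sobolev_exponent; field; rewrite gt_eqF.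
Qed.

Lemma conformal_energy_density (v : 'rV[R]_N -> R) x : 0 < d x ->
  conformal_norm A x (conformal_gradient A v x) ^+ 2 * A x ^+ N =
  d x * enorm (gradient v x) ^+ 2.
Proof.
move=> dx; have A0 : 0 < A x by exact: powR_gt0.
have AN : A x ^+ N = d x * A x ^+ 2.
  have -> : d x = A x ^+ (N - 2).
    rewrite -powR_mulrn ?(ltW A0)// -powRrM natrB ?(ltnW N3)// mulVf ?gt_eqF//.
    by rewrite powRr1 ?ltW.
  by rewrite -exprD subnK// ltnW.
rewrite AN /conformal_norm enormZ ger0_norm ?invr_ge0 ?exprn_ge0 ?(ltW A0)//.
by field; rewrite gt_eqF.
Qed.

End conformal_quantities.

Lemma measurable_powR_comp (R : realType) n (D : set 'rV[R]_n) (f : 'rV[R]_n -> R)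
    (a : R) : continuous f ->
  measurable_fun (D : set (borel_rV R n))
    ((fun x => f x `^ a) : borel_rV R n -> measurableTypeR R).
Proof.
move=> cf; apply: measurable_funTS.
apply: (measurableT_comp (measurable_powR a)).
exact: continuous_measurable_fun_rV.
Qed.

Theorem theorem4 (R : realType) (N : nat) (Om : set 'rV[R]_N) (C : R)
    (hN : (3 <= N)%N) (domOm : is_domain Om) (properOm : Om <> setT)
    (C0 : 0 < C) (hsm : hardy_sobolev_mazya Om C)
    (subh : dist_subharmonic Om) (v : 'rV[R]_N -> R)
    (hv : test_function Om v) :
  let A := dist_factor Om in
  let p := sobolev_exponent R N in
  ((C `^ 2^-1)%R%:E *
     conformal_integral A Om (fun x => `|v x| `^ p)%R `^ (p^-1)%R
   <= conformal_integral A Om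
        (fun x => conformal_norm A x (conformal_gradient A v x) ^+ 2)%R
      `^ (2^-1)%R)%E.
Proof.
lazy zeta; set A := dist_factor Om; set p := sobolev_exponent R N.
have N2 := dimension_gt2 R hN.
have N0 : 0 < N%:R :> R by rewrite ltr0n (leq_trans _ hN).
have [oOm _ _] := domOm; have [sv cK KOm] := hv.
set K := support_closure v in cK KOm.
have d_gt0 x : Om x -> 0 < boundary_dist Om x by exact: boundary_dist_gt0.
pose q : R := (N%:R - 2) / N%:R.
have q0 : 0 < q by rewrite divr_gt0.
have pq : 2^-1 * p * q = 1.
  by rewrite /p /q /sobolev_exponent; field; rewrite !gt_eqF.
have p0 : 0 < p by rewrite /p /sobolev_exponent divr_gt0// mulr_gt0.
have pV : p^-1 = q * 2^-1.
  by apply: (mulfI (lt0r_neq0 p0)); rewrite divff ?gt_eqF// -[LHS]pq; ring.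
have sE := supported_weighted_energy domOm properOm hv.
rewrite [X in (_ <= X `^ _)%E](_ : _ = (integral_on Om (weighted_energy Om v))%:E);
  last first.
  rewrite -(integral_onE oOm cK sE); apply: eq_integral => x /[!inE] Omx.
  by rewrite conformal_energy_density// d_gt0.
set X := integral_on _ _; rewrite /conformal_integral; set W := (\int[_]_(x in _) _)%E.
have W0 : (0 <= W)%E.
  by apply: integral_ge0 => x _; rewrite lee_fin mulr_ge0 ?exprn_ge0 ?powR_ge0.
have mOm : measurable (Om : set (borel_rV R N)) by exact: open_measurable_rV.
have cnorm (f : 'rV[R]_N -> R) : continuous f -> continuous (fun x => `|f x|).
  by move=> cf x; apply: continuous_comp; [exact: cf | exact: norm_continuous].
have [Z HZ] := perturbed_hsm domOm properOm hv hsm subh.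
have main : (C%:E * W `^ q <= X%:E)%E.
  apply: (@lee_vanishing_error _ C X Z) => // [|e e0 e2]; first exact: poweR_ge0.
  have [u [su uK ul hu]] := HZ e e0 e2.
  apply: le_trans hu; rewrite lee_pmul2l//.
  have e1 : 0 < 1 - e by rewrite subr_gt0; lra.
  (* inside the power [q], the factor [1 - e] becomes [(1 - e)^(p/2)], which
     is compared with the integrand *)
  have -> : ((1 - e)%:E = ((1 - e) `^ (2^-1 * p))%:E `^ q)%E.
    by rewrite poweR_EFin -powRrM pq powRr1// ltW.
  have mW : measurable_fun (Om : set (borel_rV R N))
      ((fun x => (`|v x| `^ p * A x ^+ N)%:E) : borel_rV R N -> \bar R).
    apply/measurable_EFinP; rewrite /A.
    under eq_fun do rewrite dist_factor_volume//.
    apply: measurable_funM; apply: measurable_powR_comp.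
      exact/cnorm/smooth_continuous.
    exact: continuous_boundary_dist.
  rewrite -poweRM ?lee_fin ?powR_ge0//; apply: gt0_ler_poweR.
  - exact: ltW.
  - by rewrite in_itv/= leey andbT mule_ge0// lee_fin powR_ge0.
  - rewrite in_itv/= leey andbT; apply: integral_ge0 => x _.
    by rewrite lee_fin powR_ge0.
  rewrite /W -ge0_integralZl_EFin ?powR_ge0//; last first.
    by move=> x _; rewrite lee_fin mulr_ge0 ?exprn_ge0 ?powR_ge0.
  apply: ge0_le_integral => //.
  - by move=> x _; rewrite lee_fin !mulr_ge0 ?exprn_ge0 ?powR_ge0.
  - exact: measurable_funeM.
  - apply/measurable_EFinP; apply: measurable_powR_comp.
    exact/cnorm/smooth_continuous.
  - move=> x Omx; rewrite lee_fin /A dist_factor_volume//.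
    have [Kx|Kx] := pselect (K x); last first.
      by rewrite (support_closure_vanish Kx) normr0 powR0 ?gt_eqF// mul0r mulr0 powR_ge0.
    have dx := d_gt0 x Omx.
    rewrite mulrCA -powRM ?(ltW e1) ?(ltW dx)// mulrC.
    rewrite powRrM -powRM ?powR_ge0//; apply: (ge0_ler_powR (ltW p0)).
    - by rewrite nnegrE mulr_ge0 ?powR_ge0.
    - by rewrite nnegrE.
    - exact: ul.
rewrite pV poweRrM -poweR_EFin -poweRM ?poweR_ge0 ?lee_fin ?(ltW C0)//.
apply: gt0_ler_poweR => //; rewrite ?in_itv/= ?leey ?andbT.
- by rewrite mule_ge0 ?poweR_ge0// lee_fin ltW.
- apply: le_trans main; by rewrite mule_ge0 ?poweR_ge0// lee_fin ltW.
Qed.
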